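(* Let $\lambda\in\mathbb{C}$ and let $S_\lambda$ be the $\lambda$-shift algebra, i.e. the complex unital associative algebra generated by $a$ and $a^\dagger$ subject to the relation $aa^\dagger-a^\dagger a=\lambda a$. Then for every integer $n\ge 0$, \[ (a^\dagger a)^n=\sum_{k=0}^n {n \brack k}_\lambda (a^\dagger)^k a^n , \] where ${n \brack k}_\lambda$ are the unsigned $\lambda$-Stirling numbers of the first kind.
   Context: For $\lambda\in\mathbb{C}$, the $\lambda$-rising factorial is $\langle x\rangle_{0,\lambda}=1$, $\langle x\rangle_{n,\lambda}=x(x+\lambda)\cdots(x+(n-1)\lambda)$ for $n\ge1$. The unsigned $\lambda$-Stirling numbers of the first kind ${n \brack k}_\lambda$ ($0\le k\le n$) are defined by $\langle x\rangle_{n,\lambda}=\sum_{k=0}^n {n \brack k}_\lambda x^k$. *)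

(* Defs.v *)
From HB Require Import structures.
From mathcomp Require Import all_boot all_order all_algebra.
From mathcomp Require Import ring_quotient.
From mathcomp Require Import boolp reals complex.
From mathcomp.multinomials Require Import monalg.

Set Implicit Arguments.
Unset Strict Implicit.
Unset Printing Implicit Defensive.

Import GRing.Theory.
Local Open Scope ring_scope.
Local Open Scope quotient_scope.

Definition lambda_rising (A : pzRingType) (lam x : A) (n : nat) : A :=
  \prod_(i < n) (x + lam *+ i).

(* The defining identity of the numbers is read as an identity of polynomials
   in the indeterminate 'X. *)
Definition lambda_stirling1 (K : comNzRingType) (lam : K) (n k : nat) : K :=
  (lambda_rising lam%:P 'X n)`_k.

(* The free unital algebra on two generators, as the monoid algebra of the
   free monoid on the two letters false (for a) and true (for its dagger).
   The library makes a monoid algebra an algType only when the monoid is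
   commutative, whence the alias. *)
Definition free_alg (K : comNzRingType) : Type := {malg K[{fmonom bool}]}.

HB.instance Definition _ (K : comNzRingType) := GRing.Lalgebra.on (free_alg K).

Lemma free_alg_scalerAr (K : comNzRingType) (c : K) (x y : free_alg K) :
  c *: (x * y) = x * (c *: y).
Proof.
apply/malgP => m; rewrite mcoeffZ malgME (@malgMEw _ _ (msupp x) (msupp y)) //;
  last exact: msuppZ_le.
rewrite !raddf_sum mulr_sumr; apply: eq_bigr => i _.
rewrite !raddf_sum mulr_sumr; apply: eq_bigr => j _ /=.
by rewrite !mcoeffU mcoeffZ -!mulrnAr mulrCA.
Qed.

HB.instance Definition _ (K : comNzRingType) :=
  GRing.Lalgebra_isAlgebra.Build K (free_alg K) (@free_alg_scalerAr K).

(* The augmentation, which kills both generators; it shows that the ideal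
   below is proper. *)
Definition free_aug (K : comNzRingType) : free_alg K -> K :=
  @mcoeff {fmonom bool} K mone.

HB.instance Definition _ (K : comNzRingType) := GRing.RMorphism.copy
  (@free_aug K) (@mcoeff {fmonom bool} K mone).

Section ShiftAlgebra.

Variables (K : fieldType) (lam : K).

Local Notation free_alg := (free_alg K).

Definition free_gen (b : bool) : free_alg := << fmu b >>.

Definition shift_relator : free_alg :=
  free_gen false * free_gen true - free_gen true * free_gen false
  - lam *: free_gen false.

(* In a unital algebra, the two-sided ideal generated by one element r is the
   set of finite sums of products x * r * y. *)
Definition shift_ideal : {pred free_alg} := fun x =>
  `[< exists s : seq (free_alg * free_alg),
        x = \sum_(p <- s) p.1 * shift_relator * p.2 >].

Lemma shift_idealP x : reflect
  (exists s : seq (free_alg * free_alg),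
     x = \sum_(p <- s) p.1 * shift_relator * p.2) (x \in shift_ideal).
Proof. exact: asboolP. Qed.

Lemma shift_idealMl x y : y \in shift_ideal -> x * y \in shift_ideal.
Proof.
move=> /shift_idealP[s ->]; apply/shift_idealP.
exists [seq (x * p.1, p.2) | p <- s].
by rewrite big_map mulr_sumr; apply: eq_bigr => p _ /=; rewrite !mulrA.
Qed.

Lemma shift_idealMr x y : x \in shift_ideal -> x * y \in shift_ideal.
Proof.
move=> /shift_idealP[s ->]; apply/shift_idealP.
exists [seq (p.1, p.2 * y) | p <- s].
by rewrite big_map mulr_suml; apply: eq_bigr => p _ /=; rewrite !mulrA.
Qed.

Lemma shift_ideal_zmod_closed : zmod_closed shift_ideal.
Proof.
split=> [|x y /shift_idealP[s ->] yI].
  by apply/shift_idealP; exists [::]; rewrite big_nil.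
have /shift_idealP[t Et] := shift_idealMl (- 1) yI.
apply/shift_idealP; exists (s ++ t).
by rewrite big_cat /= -Et mulN1r.
Qed.

HB.instance Definition _ :=
  GRing.isZmodClosed.Build free_alg shift_ideal shift_ideal_zmod_closed.

Lemma shift_relator_in : shift_relator \in shift_ideal.
Proof.
by apply/shift_idealP; exists [:: (1, 1)]; rewrite big_seq1 mul1r mulr1.
Qed.

Lemma free_aug_gen b : free_aug (free_gen b) = 0.
Proof. by rewrite /free_aug /free_gen mcoeffU fm1_eq1. Qed.

Lemma free_aug_relator : free_aug shift_relator = 0.
Proof.
rewrite /shift_relator !rmorphB !rmorphM /= -mulr_algl rmorphM /=.
by rewrite !free_aug_gen !mulr0 !subr0.
Qed.

Lemma shift_ideal1 : (1 : free_alg) \notin shift_ideal.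
Proof.
apply/shift_idealP => -[s /(congr1 (@free_aug K))].
rewrite rmorph1 rmorph_sum big1 => [/eqP|p _]; first by rewrite oner_eq0.
by rewrite !rmorphM /= free_aug_relator mulr0 mul0r.
Qed.

Definition shift_alg : Type := Quotient.quot shift_ideal.

HB.instance Definition _ := GRing.Zmodule.on shift_alg.
HB.instance Definition _ := EqQuotient.on shift_alg.

Lemma shift_piP (x y : free_alg) :
  reflect (\pi_shift_alg x = \pi_shift_alg y) (x - y \in shift_ideal).
Proof. by rewrite Quotient.idealrBE; exact: eqP. Qed.

Lemma shift_piB (x y : free_alg) :
  \pi_shift_alg (x - y) = \pi_shift_alg x - \pi_shift_alg y.
Proof. exact: (raddfB (\pi_(Quotient.quot shift_ideal))). Qed.

Lemma shift_piD (x y : free_alg) :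
  \pi_shift_alg (x + y) = \pi_shift_alg x + \pi_shift_alg y.
Proof. exact: (raddfD (\pi_(Quotient.quot shift_ideal))). Qed.

Definition shift_one : shift_alg := \pi_shift_alg 1.
Definition shift_mul := lift_op2 shift_alg *%R.
Definition shift_scale (c : K) := lift_op1 shift_alg ( *:%R c).

Lemma shift_repr x : repr (\pi_shift_alg x) - x \in shift_ideal.
Proof. by apply/shift_piP; rewrite reprK. Qed.

Lemma shift_piM x y :
  \pi_shift_alg (x * y) = shift_mul (\pi_shift_alg x) (\pi_shift_alg y).
Proof.
apply/esym; unlock shift_mul; apply/shift_piP.
set x' := repr _; set y' := repr _.
have -> : x' * y' - x * y = (x' - x) * y' + x * (y' - y).
  by rewrite mulrBl mulrBr addrA subrK.
by apply: rpredD; [apply: shift_idealMr|apply: shift_idealMl];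
  exact: shift_repr.
Qed.

Lemma shift_piZ c x : \pi_shift_alg (c *: x) = shift_scale c (\pi_shift_alg x).
Proof.
apply/esym; unlock shift_scale; apply/shift_piP.
by rewrite -scalerBr -mulr_algl; apply: shift_idealMl; exact: shift_repr.
Qed.

Lemma shift_mulA : associative shift_mul.
Proof.
move=> u v w; rewrite -[u]reprK -[v]reprK -[w]reprK.
by rewrite -!shift_piM mulrA.
Qed.

Lemma shift_mul1 : left_id shift_one shift_mul.
Proof. by move=> u; rewrite -[u]reprK -shift_piM mul1r. Qed.

Lemma shift_mulr1 : right_id shift_one shift_mul.
Proof. by move=> u; rewrite -[u]reprK -shift_piM mulr1. Qed.

Lemma shift_mulDl : left_distributive shift_mul +%R.
Proof.
move=> u v w; rewrite -[u]reprK -[v]reprK -[w]reprK.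
by rewrite -!(shift_piM, shift_piD) mulrDl.
Qed.

Lemma shift_mulDr : right_distributive shift_mul +%R.
Proof.
move=> u v w; rewrite -[u]reprK -[v]reprK -[w]reprK.
by rewrite -!(shift_piM, shift_piD) mulrDr.
Qed.

Lemma shift_one_neq0 : shift_one != 0.
Proof.
apply/eqP => e; have /negP[] := shift_ideal1.
rewrite -[1]subr0; apply/shift_piP.
by rewrite -[RHS]/(\pi_shift_alg 0) -(subrr (1 : free_alg)) shift_piB subrr.
Qed.

HB.instance Definition _ := GRing.Zmodule_isNzRing.Build shift_alg
  shift_mulA shift_mul1 shift_mulr1 shift_mulDl shift_mulDr shift_one_neq0.

Lemma shift_scaleA c d u :
  shift_scale c (shift_scale d u) = shift_scale (c * d) u.
Proof. by rewrite -[u]reprK -!shift_piZ scalerA. Qed.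

Lemma shift_scale1 : left_id 1 shift_scale.
Proof. by move=> u; rewrite -[u]reprK -shift_piZ scale1r. Qed.

Lemma shift_scaleDr : right_distributive shift_scale +%R.
Proof.
move=> c u v; rewrite -[u]reprK -[v]reprK.
by rewrite -!(shift_piZ, shift_piD) scalerDr.
Qed.

Lemma shift_scaleDl u : {morph shift_scale^~ u : c d / c + d}.
Proof.
by move=> c d; rewrite -[u]reprK -!(shift_piZ, shift_piD) scalerDl.
Qed.

HB.instance Definition _ := GRing.Zmodule_isLmodule.Build K shift_alg
  shift_scaleA shift_scale1 shift_scaleDr shift_scaleDl.

Lemma shift_scaleAl (c : K) (u v : shift_alg) : c *: (u * v) = (c *: u) * v.
Proof.
rewrite -[u]reprK -[v]reprK.
by rewrite -[LHS]/(shift_scale _ (shift_mul _ _))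
  -[RHS]/(shift_mul (shift_scale _ _) _) -!(shift_piM, shift_piZ) scalerAl.
Qed.

HB.instance Definition _ :=
  GRing.Lmodule_isLalgebra.Build K shift_alg shift_scaleAl.

Lemma shift_scaleAr (c : K) (u v : shift_alg) : c *: (u * v) = u * (c *: v).
Proof.
rewrite -[u]reprK -[v]reprK.
by rewrite -[LHS]/(shift_scale _ (shift_mul _ _))
  -[RHS]/(shift_mul _ (shift_scale _ _)) -!(shift_piM, shift_piZ) scalerAr.
Qed.

HB.instance Definition _ :=
  GRing.Lalgebra_isAlgebra.Build K shift_alg shift_scaleAr.

Definition shift_a : shift_alg := \pi_shift_alg (free_gen false).
Definition shift_adag : shift_alg := \pi_shift_alg (free_gen true).

Lemma shift_rel :
  shift_a * shift_adag - shift_adag * shift_a = lam *: shift_a.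
Proof.
rewrite /shift_a /shift_adag.
rewrite -[_ * _]shift_piM -[X in _ - X]shift_piM -[RHS]shift_piZ -shift_piB.
exact/shift_piP/shift_relator_in.
Qed.

End ShiftAlgebra.

(* Main.v *)
Require Import Defs.
From mathcomp Require Import all_boot all_order all_algebra.
From mathcomp Require Import reals complex.

Import GRing.Theory.
Local Open Scope ring_scope.
Local Open Scope complex_scope.

(* The relation lets d move to the left across a power of a, which shifts it:
   a^n d = (d + n lam) a^n.  Hence (d a)^n = d (d + lam) ... (d + (n-1) lam) a^n,
   where the first factor is the lam-rising factorial evaluated at d. *)

Lemma lambda_risingS (A : pzRingType) (lam x : A) (n : nat) :
  lambda_rising lam x n.+1 = lambda_rising lam x n * (x + lam *+ n).
Proof. by rewrite /lambda_rising big_ord_recr. Qed.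

Lemma size_lambda_rising (K : comNzRingType) (lam : K) (n : nat) :
  (size (lambda_rising lam%:P 'X n) <= n.+1)%N.
Proof.
elim: n => [|n IHn]; first by rewrite /lambda_rising big_ord0 size_poly1.
rewrite lambda_risingS -polyCMn.
apply: leq_trans (size_polyMleq _ _) _.
by rewrite size_XaddC addn2.
Qed.

(** The numbers are coefficients of a polynomial in ['X]; evaluation at [x] is an algebra morphism
    even when [A] is noncommutative, since only scalars and powers of the single element [x]
    occur. *)
Lemma lambda_rising_algE (K : comNzRingType) (A : algType K) (lam : K) (x : A)
    (n : nat) :
  lambda_rising lam%:A x n = \sum_(k < n.+1) lambda_stirling1 lam n k *: x ^+ k.
Proof.
have -> : lambda_rising lam%:A x n = horner_alg x (lambda_rising lam%:P 'X n).
  rewrite /lambda_rising rmorph_prod; apply: eq_bigr => i _.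
  by rewrite rmorphD rmorphMn /= horner_algX horner_algC.
have -> : lambda_rising lam%:P 'X n
    = \sum_(k < n.+1) lambda_stirling1 lam n k *: 'X^k.
  (* Beyond degree [n] the right side has coefficient 0 by truncation, the left side by the degree
     bound. *)
  apply/polyP => i; rewrite -poly_def coef_poly; case: ltnP => // ni.
  by rewrite nth_default // (leq_trans (size_lambda_rising _ _ _)).
rewrite rmorph_sum; refine (eq_bigr _ _) => k _ /=.
by rewrite -mul_polyC rmorphM rmorphXn /= horner_algX horner_algC mulr_algl.
Qed.

Lemma shift_expr_mul (K : comNzRingType) (A : algType K) (lam : K) (a d : A)
    (n : nat) :
  a * d - d * a = lam *: a -> a ^+ n * d = (d + lam%:A *+ n) * a ^+ n.
Proof.
move=> ad; elim: n => [|n IHn]; first by rewrite !expr0 mul1r addr0 mulr1.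
(* The innermost [a * d] becomes [lam *: a + d * a]: the second term falls to the induction
   hypothesis, the first supplies the one extra [lam%:A]. *)
rewrite exprSr -mulrA -[a * d](subrK (d * a)) ad mulrDr mulrA IHn.
rewrite -scalerAr -exprSr -mulrA -exprSr mulrSr addrA.
rewrite [in RHS]mulrDl mulr_algl; exact: addrC.
Qed.

Lemma shift_mul_expr (K : comNzRingType) (A : algType K) (lam : K) (a d : A)
    (n : nat) :
  a * d - d * a = lam *: a ->
  (d * a) ^+ n = lambda_rising lam%:A d n * a ^+ n.
Proof.
move=> ad; elim: n => [|n IHn]; first by rewrite /lambda_rising big_ord0 !expr0 mulr1.
(* The [d] of the last factor [d * a] crosses [a ^+ n] and becomes [d + lam%:A *+ n], exactly the
   next factor of the rising factorial. *)
rewrite exprSr IHn -mulrA (mulrA (a ^+ n)) (shift_expr_mul _ _ _ _ _ _ ad).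
by rewrite -(mulrA _ _ a) -exprSr mulrA lambda_risingS.
Qed.

Theorem theorem1 (R : realType) (lam : R[i]) (n : nat) :
  (shift_adag lam * shift_a lam) ^+ n
  = \sum_(k < n.+1)
      lambda_stirling1 lam n k *: (shift_adag lam ^+ k * shift_a lam ^+ n).
Proof.
rewrite (shift_mul_expr _ _ _ _ _ _ (shift_rel lam)) lambda_rising_algE mulr_suml.
by apply: eq_bigr => k _; rewrite scalerAl.
Qed.
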